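(* Let $B$ be a subset of a finite set $A$. Then $I_{B,A} \approx (A\,\Delta\, B) \times S_B$.
   Context: A set $E$ is finite if $\mathcal{P}(E)$ is the only subset $\mathcal{S}$ of the power set $\mathcal{P}(E)$ such that $\varnothing \in \mathcal{S}$ and $F \cup \{e\} \in \mathcal{S}$ whenever $F \in \mathcal{S}$, $F \neq E$ and $e \in E \setminus F$ (this is equivalent to the usual notion of finiteness). For sets $E,F$ write $E \approx F$ if there exists a bijective mapping $E \to F$. For a finite set $A$ and $B \subset A$ let $A \,\Delta\, B = \{ C \in \mathcal{P}(A) : C \approx B\}$, and let $I_{B,A}$ be the set of injective mappings $k : B \to A$. For a finite set $C$ let $S_C$ be the set of bijections $h : C \to C$. *)

(* Defs.v *)
From mathcomp Require Import all_boot all_classical.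

Set Implicit Arguments.
Unset Strict Implicit.
Unset Printing Implicit Defensive.

Local Open Scope classical_set_scope.

Definition power_set (T : Type) (E : set T) : set (set T) :=
  [set F | F `<=` E].

(* Finiteness without numbers; the library's [finite_set] instead asks for a
   bijection with an initial segment of [nat]. *)
Definition finite (T : Type) (E : set T) : Prop :=
  forall S : set (set T),
    S `<=` power_set E ->
    S set0 ->
    (forall (F : set T) (e : T),
        S F -> F <> E -> (E `\` F) e -> S (F `|` [set e])) ->
    S = power_set E.

Definition Delta (T : Type) (A B : set T) : set (set T) :=
  [set C | power_set A C /\ (C #= B)%card].

(* A [set T] used as a type is the subtype of its elements, so [B -> A] is the
   type of mappings between the sets themselves. *)
Definition inj_maps (T : Type) (B A : set T) : set (B -> A) :=
  [set k | injective k].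
Arguments inj_maps {T} B A _.

Definition bij_maps (T : Type) (C : set T) : set (C -> C) :=
  [set h | bijective h].
Arguments bij_maps {T} C _.

(* Main.v *)
Require Import Defs.
From mathcomp Require Import all_boot all_classical.

Local Open Scope classical_set_scope.

(** An injection [k : B -> A] is determined by its image, which is a subset of
    [A] equipotent to [B], together with the way it labels that image by the
    elements of [B].  To make the labelling a permutation of [B], choose for
    every [C] in [Delta A B] one reference injection [phi C : B -> A] with
    image [C] ([ex_inj_onto]).  Then [(C, h) |-> phi C \o h] is the required
    bijection from [Delta A B `*` bij_maps B] to [inj_maps B A]:
    - the image of [phi C \o h] is [C], so [C] can be recovered from it, and then
      so can [h], because [phi C] is injective;
    - an injection [k] with image [C] has the same image as [phi C], and two
      injections with the same image differ by a permutation of their domain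
      ([inj_same_range]). *)

(** The factor [h] sends [x] to the unique point that [f] maps to [g x]; the
    same construction with [f] and [g] exchanged yields its inverse. *)
Lemma inj_same_range {X Y : Type} {f g : X -> Y} :
  injective f -> injective g -> range f = range g ->
  exists2 h : X -> X, bijective h & g = f \o h.
Proof.
move=> finj ginj fg.
have /choice[h hE] : forall x, exists y, f y = g x.
  move=> x.
  by have [y _ <-] : range f (g x) by [rewrite fg; exists x]; exists y.
have /choice[h' h'E] : forall x, exists y, g y = f x.
  move=> x.
  by have [y _ <-] : range g (f x) by [rewrite -fg; exists x]; exists y.
exists h; last by apply/funext => x /=; rewrite hE.
exists h' => x; first by apply: ginj; rewrite h'E hE.
by apply: finj; rewrite hE h'E.
Qed.

Lemma range_comp_bij {X Y : Type} (f : X -> Y) {h : X -> X} :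
  bijective h -> range (f \o h) = range f.
Proof.
move=> [h' _ h'K]; apply/seteqP; split=> [_ [x _ <-]|_ [x _ <-]].
  by exists (h x).
by exists (h' x) => //=; rewrite h'K.
Qed.

Lemma ex_inj_onto {T : Type} {A B C : set T} :
  Delta A B C ->
  exists2 k : B -> A, injective k & range (val \o k) = C.
Proof.
move=> [CA]; rewrite card_eq_sym => /card_bijP[f [f' fK f'K]].
exists (fun b => SigSub (mem_set (CA _ (set_valP (f b))))).
  by move=> b b' [/val_inj/(can_inj fK)].
apply/seteqP; split=> [_ [b _ <-]|c Cc] /=; first exact: set_valP.
by exists (f' (SigSub (mem_set Cc))) => //=; rewrite f'K.
Qed.

Lemma Delta_range {T : Type} {A B : set T} {k : B -> A} :
  injective k -> Delta A B (range (val \o k)).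
Proof.
move=> kinj; split=> [_ [b _ <-]|]; first exact: set_valP.
apply: card_eq_trans (card_setT B).
by apply: inj_card_eq => b b' _ _ /val_inj/kinj.
Qed.

Theorem theorem4p2 (T : Type) (A B : set T) (finA : finite A) (BA : B `<=` A) :
  (inj_maps B A #= Delta A B `*` bij_maps B)%card.
Proof.
have /choice[phi phiP] : forall C, exists k : B -> A, Delta A B C ->
    injective k /\ range (val \o k) = C.
  move=> C; have [/ex_inj_onto[k]|nC] := pselect (Delta A B C).
    by exists k.
  (* Outside [Delta A B] any map serves as a value; the inclusion is one. *)
  by exists (fun b => SigSub (mem_set (BA _ (set_valP b)))).
pose F (p : set T * (B -> B)) : B -> A := phi p.1 \o p.2.
have FE : F @` (Delta A B `*` bij_maps B) = inj_maps B A.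
  apply/seteqP; split=> [_ [[C h] [/phiP[phi_inj _] hbij] <-]|k kinj].
    exact: inj_comp phi_inj (bij_inj hbij).
  have DC := Delta_range kinj; have [phi_inj phi_range] := phiP _ DC.
  have [h hbij kE] := inj_same_range (inj_comp val_inj phi_inj)
    (inj_comp val_inj kinj) phi_range.
  exists (range (val \o k), h) => //.
  by apply/funext => b; apply: val_inj; have := congr1 (@^~ b) kE.
rewrite -FE; apply: inj_card_eq => -[C h] [C' h'].
rewrite !inE => -[/= DC hbij] [/= DC' h'bij] FF.
have [phi_inj phiC] := phiP _ DC; have [_ phiC'] := phiP _ DC'.
have CC' : C = C'.
  rewrite -phiC -(range_comp_bij _ hbij) -phiC' -(range_comp_bij (_ \o phi C') h'bij).
  exact: (congr1 (fun k : B -> A => range (val \o k)) FF).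
rewrite -CC' in FF *; congr pair; apply/funext => b.
by apply: phi_inj; rewrite -[LHS]/(F (C, h) b) FF.
Qed.
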